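(* Let $\mu$ be product measure on $\{0,1\}^{\mathbb{Z}^d}$ with parameter $p\in(0,1)$ the reciprocal of an integer, and let $\Gamma$ have law $\mu$. If $d=1$ or $d=2$, then any balanced allocation rule $\Phi$ for $\mu$ satisfies $$\mathbf{E}\|\Phi_\Gamma(0)\|^{d/2}=\infty.$$
   Context: $\|\cdot\|$ is the Euclidean norm. Under product measure with parameter $p$ the coordinates $\Gamma(x)$ are i.i.d. with $\mathbf{P}(\Gamma(x)=1)=p=1-\mathbf{P}(\Gamma(x)=0)$. For $z\in\mathbb{Z}^d$, $T^z$ acts on sites by $T^zx=x+z$ and on configurations $\gamma\in\{0,1\}^{\mathbb{Z}^d}$ by $(T^{z}\gamma)(y)=\gamma(y-z)$. A balanced allocation rule for $\mu$ is a measurable map $\Phi$ which assigns to $\mu$-almost-every configuration $\gamma$ and every site $x\in\mathbb{Z}^d$ a site $\Phi_\gamma(x)\in\mathbb{Z}^d$ such that: (a) $|(\Phi_\gamma)^{-1}(y)|=p^{-1}\gamma(y)$ for $\mu$-almost-all $\gamma$ and all $y\in\mathbb{Z}^d$; (b) if $\Phi_\gamma(x)=y$, then $\Phi_{T^z\gamma}(T^zx)=T^zy$, for all $z\in\mathbb{Z}^d$. *)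

(* Defs.v *)
From mathcomp Require Import all_boot all_order all_algebra.
From mathcomp Require Import all_classical all_reals all_analysis.
Set Implicit Arguments.
Unset Strict Implicit.
Unset Printing Implicit Defensive.
Import Order.TTheory GRing.Theory Num.Theory.
Local Open Scope classical_set_scope.
Local Open Scope ring_scope.

Notation site d := 'rV[int]_d.

Definition enorm (R : realType) (d : nat) (x : site d) : R :=
  Num.sqrt (\sum_(i < d) (x 0 i)%:~R ^+ 2).

Definition coordinate_events (d : nat) : set (set (site d -> bool)) :=
  [set C | exists (x : site d) (B : set bool), C = [set g | B (g x)]].

(* {0,1}^(Z^d) with the product sigma-algebra, the one generated by the
   coordinate maps; [true] encodes 1. *)
Definition config (d : nat) := g_sigma_algebraType (@coordinate_events d).

Definition shift_config (d : nat) (z : site d) (g : config d) : config d :=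
  fun y => g (y - z).

(* The library has no infinite product of measures: the product measure is
   the (unique) probability on the product sigma-algebra whose value on every
   finite-dimensional box is the product of the marginal probabilities. *)
Definition is_product_measure (R : realType) (d : nat) (p : R)
    (mu : probability (config d) R) : Prop :=
  forall (s : seq (site d)) (B : site d -> set bool), uniq s ->
    mu [set g : config d | forall x, x \in s -> B x (g x)]
    = (\prod_(x <- s) bernoulli_prob p (B x))%E.

(* [Phi g x = None] means that the rule is undefined at [g] and [x].
   In [bar_measurable], sites carry the discrete sigma-algebra. In
   [bar_balanced], [counting] is +oo on infinite sets, so fibres are finite. *)
Record balanced_allocation_rule (R : realType) (d : nat) (p : R)
    (mu : probability (config d) R)
    (Phi : config d -> site d -> option (site d)) : Prop := {
  bar_measurable : forall (x : site d) (B : set (option (site d))),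
    measurable [set g : config d | B (Phi g x)] ;
  bar_defined : {ae mu, forall g : config d, forall x : site d,
    Phi g x <> None} ;
  bar_balanced : {ae mu, forall g : config d, forall y : site d,
    counting [set x : site d | Phi g x = Some y] = (p^-1 * (g y)%:R)%:E} ;
  bar_equivariant : forall (g : config d) (x y : site d), Phi g x = Some y ->
    forall z : site d, Phi (shift_config z g) (x + z) = Some (y + z)
}.

(* The norm of an allocated site; the value 0 at [None] is immaterial, since
   an allocation rule is almost surely defined. *)
Definition allocation_norm (R : realType) (d : nat) (y : option (site d)) : R :=
  enorm R (odflt 0 y).

(* Main.v *)
Require Import Defs.
From mathcomp Require Import all_boot all_order all_algebra.
From mathcomp Require Import all_classical all_reals all_analysis.
From mathcomp Require Import measurable_realfun ring lra zify.
Set Implicit Arguments.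
Unset Strict Implicit.
Unset Printing Implicit Defensive.
Import Order.TTheory GRing.Theory Num.Theory.
Local Open Scope classical_set_scope.
Local Open Scope ring_scope.

(** Suppose that the expectation is finite. Fix a large cube [B] of
    [N = n ^ d] sites and let [D] be its excess, the sum over [y] in [B] of
    [Gamma y / p - 1]: the number of sites allocated to [B] minus the number
    of sites in [B]. The proof compares two estimates of the covariance of [D]
    with the bounded variable [G], which is [c * D / sqrt N] truncated to
    [-1, 1].

    Lower bound. As [D] is a sum of [N] independent centred variables, its
    second moment is of order [N] and its fourth moment of order [N ^ 2], and
    [x * clamp x >= x ^ 2 - x ^ 4]; for a suitable [c] the covariance is
    therefore at least [delta * sqrt N] ([excess_clamp_lower]).

    Upper bound. By mass balance, [D] is the number of sites outside [B]
    allocated inside, minus the number of sites inside allocated outside. Sort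
    them by the displacement [v] from a site to its image. The translation by
    [v] carries at most of order [sqrt N * |v| ^ (d / 2)] sites through the
    boundary of [B]; this is where [d <= 2] is used ([size_exits_le]). Hence
    the covariance is at most of order [sqrt N] times the sum over [v] of
    [|v| ^ (d / 2) * eps v], where [eps v] is the largest covariance of [G]
    with an event that a given site is displaced by [v]. On the one hand,
    [eps v] is at most twice the probability [q v] of the displacement [v],
    and the sum of [|v| ^ (d / 2) * q v] is the expectation assumed finite. On
    the other hand, each [eps v] tends to 0 as the cube grows: [G] hardly
    depends on any fixed number of coordinates, so that it is asymptotically
    independent of every event, uniformly over the translates of the event
    ([mixing_measurable]). So the covariance is [o(sqrt N)], a contradiction.

    To stay with finite sums of bounded variables, displacements are
    restricted to a finite list [V], chosen after [N] and so large that the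
    neglected sites contribute at most a small multiple of [sqrt N]
    ([mean_excess_probe_le], [move_prob_exhaust]). *)

(** * Bounded random variables *)

Section BoundedExpectation.
Context {disp : measure_display} {T : measurableType disp} {R : realType}.
Variable P : probability T R.
Implicit Types f g : T -> R.

(** Such functions are integrable for every probability, and stable under the
    ring operations. *)
Definition bounded_measurable f :=
  measurable_fun setT f /\ exists M : R, forall x, `|f x| <= M.

(** The expectation as a real number, meaningful for bounded measurable
    functions. *)
Definition mean f : R := \int[P]_x f x.

Lemma bounded_measurable_cst (c : R) : bounded_measurable (fun=> c).
Proof. by split; [exact: measurable_cst | exists `|c|]. Qed.

Lemma bounded_measurableD f g : bounded_measurable f -> bounded_measurable g ->
  bounded_measurable (fun x => f x + g x).
Proof.
move=> [mf [M fM]] [mg [N gN]]; split; first exact: measurable_funD.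
by exists (M + N) => x; rewrite (le_trans (ler_normD _ _))// lerD.
Qed.

Lemma bounded_measurableM f g : bounded_measurable f -> bounded_measurable g ->
  bounded_measurable (fun x => f x * g x).
Proof.
move=> [mf [M fM]] [mg [N gN]]; split; first exact: measurable_funM.
by exists (M * N) => x; rewrite normrM ler_pM.
Qed.

Lemma bounded_measurableZ (c : R) f : bounded_measurable f ->
  bounded_measurable (fun x => c * f x).
Proof. exact: bounded_measurableM (bounded_measurable_cst c). Qed.

Lemma bounded_measurableB f g : bounded_measurable f -> bounded_measurable g ->
  bounded_measurable (fun x => f x - g x).
Proof.
move=> hf hg; rewrite (_ : (fun x => _) = (fun x => f x + (-1) * g x)).
  by apply: bounded_measurableD => //; exact: bounded_measurableZ.
by apply/funext => x; rewrite mulN1r.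
Qed.

Lemma bounded_measurable_sum (I : Type) (s : seq I) (F : I -> T -> R) :
  (forall i, bounded_measurable (F i)) ->
  bounded_measurable (fun x => \sum_(i <- s) F i x).
Proof.
move=> hF; elim: s => [|i s IH].
  under eq_fun do rewrite big_nil.
  exact: bounded_measurable_cst.
under eq_fun do rewrite big_cons.
exact: bounded_measurableD.
Qed.

Lemma bounded_measurable_indic (A : set T) : measurable A ->
  bounded_measurable (\1_A : T -> R).
Proof.
move=> mA; split; first exact: measurable_indic.
by exists 1 => x; rewrite indicE ger0_norm// lern1 leq_b1.
Qed.

Lemma bounded_measurable_max (c : R) f : bounded_measurable f ->
  bounded_measurable (fun x => Num.max (f x) c).
Proof.
move=> [mf [M fM]]; split; first by apply: measurable_maxr.
exists (M + `|c|) => x; move: (fM x); rewrite maxEle.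
by case: ifP => _ h; move: (normr_ge0 (f x)) (normr_ge0 c); lra.
Qed.

Lemma bounded_measurable_integrable f : bounded_measurable f ->
  P.-integrable setT (EFin \o f).
Proof.
move=> [mf [M fM]]; apply: (@le_integrable _ _ _ P setT _ _ (cst M%:E)) => //.
- exact/measurable_EFinP.
- by move=> x _ /=; rewrite lee_fin (le_trans (fM x))// ler_norm.
- exact: (finite_measure_integrable_cst P M measurableT).
Qed.

Lemma mean_cst (c : R) : mean (fun=> c) = c.
Proof.
rewrite /mean Rintegral_cst//; have /= -> := @probability_setT _ _ _ P.
by rewrite mulr1.
Qed.

Lemma meanD f g : bounded_measurable f -> bounded_measurable g ->
  mean (fun x => f x + g x) = mean f + mean g.
Proof.
by move=> hf hg; apply: RintegralD => //; exact: bounded_measurable_integrable.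
Qed.

Lemma meanB f g : bounded_measurable f -> bounded_measurable g ->
  mean (fun x => f x - g x) = mean f - mean g.
Proof.
by move=> hf hg; apply: RintegralB => //; exact: bounded_measurable_integrable.
Qed.

Lemma meanZ (c : R) f : bounded_measurable f ->
  mean (fun x => c * f x) = c * mean f.
Proof.
by move=> hf; apply: RintegralZl => //; exact: bounded_measurable_integrable.
Qed.

Lemma mean_sum (I : Type) (s : seq I) (F : I -> T -> R) :
  (forall i, bounded_measurable (F i)) ->
  mean (fun x => \sum_(i <- s) F i x) = \sum_(i <- s) mean (F i).
Proof.
move=> hF; elim: s => [|i s IH].
  rewrite big_nil -[RHS](mean_cst 0); congr mean.
  by apply/funext => x; rewrite big_nil.
rewrite big_cons -IH -meanD//; last exact: bounded_measurable_sum.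
by congr mean; apply/funext => x; rewrite big_cons.
Qed.

Lemma mean_ge0 f : (forall x, 0 <= f x) -> 0 <= mean f.
Proof. by move=> f0; apply: Rintegral_ge0. Qed.

Lemma le_mean f g : bounded_measurable f -> bounded_measurable g ->
  (forall x, f x <= g x) -> mean f <= mean g.
Proof.
move=> hf hg fg; apply: le_Rintegral => //.
  exact: bounded_measurable_integrable.
exact: bounded_measurable_integrable.
Qed.

Lemma mean_indic (A : set T) : measurable A -> mean (\1_A) = fine (P A).
Proof. by move=> mA; rewrite /mean /Rintegral integral_indic// setIT. Qed.

Lemma ae_mean_ge0 f : bounded_measurable f -> {ae P, forall x, 0 <= f x} ->
  0 <= mean f.
Proof.
move=> hf f0; have -> : mean f = mean (fun x => Num.max (f x) 0).
  rewrite /mean /Rintegral; congr fine; apply: ae_eq_integral => //.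
  - by apply/measurable_EFinP; case: hf.
  - by apply/measurable_EFinP; case: (bounded_measurable_max 0 hf).
  - by apply: filterS f0 => x /= f0 _; rewrite max_l.
by apply: mean_ge0 => x; rewrite le_max lexx orbT.
Qed.

Lemma ae_le_mean f g : bounded_measurable f -> bounded_measurable g ->
  {ae P, forall x, f x <= g x} -> mean f <= mean g.
Proof.
move=> hf hg fg; rewrite -subr_ge0 -meanB//.
apply: ae_mean_ge0; first exact: bounded_measurableB.
by apply: filterS fg => x; rewrite subr_ge0.
Qed.

Lemma mean_mul_le f g (K : R) : bounded_measurable f -> bounded_measurable g ->
  {ae P, forall x, 0 <= f x} -> (forall x, `|g x| <= K) ->
  `|mean (fun x => f x * g x)| <= K * mean f.
Proof.
move=> hf hg f0 gK.
have hfg := bounded_measurableM hf hg.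
rewrite ler_norml -mulNr -!meanZ//; apply/andP; split.
  apply: ae_le_mean => //; first exact: bounded_measurableZ.
  apply: filterS f0 => x f0; have := gK x; rewrite ler_norml => /andP[h _].
  by rewrite mulrC ler_wpM2l.
apply: ae_le_mean => //; first exact: bounded_measurableZ.
apply: filterS f0 => x f0; have := gK x; rewrite ler_norml => /andP[_ h].
by rewrite mulrC ler_wpM2r.
Qed.

Lemma mean_norm_le f (K : R) : bounded_measurable f ->
  (forall x, `|f x| <= K) ->
  `|mean f| <= K.
Proof.
move=> hf fK.
have := mean_mul_le (bounded_measurable_cst 1) hf (aeW P (fun=> ler01)) fK.
rewrite mean_cst mulr1; congr (`|_| <= _).
by congr mean; apply/funext => x; rewrite mul1r.
Qed.

End BoundedExpectation.

Section MassLimit.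
Context {disp : measure_display} {T : measurableType disp} {R : realType}.
Variable P : probability T R.

Lemma ndseq_mass (F : (set T)^nat) (e : R) : nondecreasing_seq F ->
  (forall i, measurable (F i)) -> 0 < e ->
  exists m, fine (P (\bigcup_i F i)) - e <= fine (P (F m)).
Proof.
move=> ndF mF e0.
have mU : measurable (\bigcup_i F i) by exact: bigcupT_measurable.
have fU : P (\bigcup_i F i) \is a fin_num by exact: fin_num_measure.
have cv : P (F n) @[n --> \oo] --> (fine (P (\bigcup_i F i)))%:E.
  by rewrite fineK//; exact: nondecreasing_cvg_mu.
have /fine_cvgP [_ /cvgrPdist_le /(_ e e0)] := cv.
case=> m _ /(_ m (leqnn m)) /= h; exists m.
by move: h; rewrite ler_norml => /andP[_]; lra.
Qed.

End MassLimit.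

(** * Cylinder events *)

Section Boxes.
Context {d : nat}.
Implicit Types (s t : seq (site d)) (B : site d -> set bool).

(** Cylinder events constraining finitely many coordinates independently. *)
Definition box s B : set (config d) :=
  [set g | forall x, x \in s -> B x (g x)].

Lemma measurable_coordinate (x : site d) (B : set bool) :
  measurable [set g : config d | B (g x)].
Proof. by apply: sub_sigma_algebra; exists x, B. Qed.

Lemma box_cons y s B :
  box (y :: s) B = [set g : config d | B y (g y)] `&` box s B.
Proof.
apply/seteqP; split=> g /=.
  move=> h; split; first by apply: h; rewrite mem_head.
  by move=> x xs; apply: h; rewrite inE xs orbT.
by move=> [h1 h2] x; rewrite inE => /orP[/eqP ->//|]; exact: h2.
Qed.

Lemma measurable_box s B : measurable (box s B).
Proof.
elim: s => [|y s IH]; last first.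
  by rewrite box_cons; apply: measurableI => //; exact: measurable_coordinate.
rewrite (_ : box _ _ = setT); first exact: measurableT.
by apply/seteqP; split.
Qed.

Lemma box_undup s B : box (undup s) B = box s B.
Proof.
by apply/seteqP; split=> g h x xs; apply: h; move: xs; rewrite mem_undup.
Qed.

Lemma eq_box s B B' : (forall x, x \in s -> B x = B' x) -> box s B = box s B'.
Proof.
by move=> e; apply/seteqP; split=> g h x xs; have := h x xs; rewrite e.
Qed.

Lemma boxI s t B C : box s B `&` box t C =
  box (s ++ t) (fun x b => (x \in s -> B x b) /\ (x \in t -> C x b)).
Proof.
apply/seteqP; split=> g /=.
  by move=> [h1 h2] x _; split; [exact: h1 | exact: h2].
move=> h; split=> x xs; have := h x;
  rewrite mem_cat xs ?orbT => /(_ isT) [h1 h2].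
  exact: h1.
exact: h2.
Qed.

Lemma setI_closed_box :
  setI_closed [set A : set (config d) | exists s B, A = box s B].
Proof. by move=> _ _ [s [B ->]] [t [C ->]]; rewrite boxI; do 2 eexists. Qed.

(** Dynkin's lemma for the product sigma-algebra: a lambda-system which
    contains all boxes contains all events. *)
Lemma box_dynkin (H : set (set (config d))) :
  (forall s B, H (box s B)) ->
  setSD_closed H -> ndseq_closed H ->
  forall A : set (config d), measurable A -> H A.
Proof.
move=> Hbox HD Hnd A mA.
have HT : H setT.
  have := Hbox [::] (fun=> setT); rewrite (_ : box _ _ = setT)//.
  by apply/seteqP; split.
have GH : [set A | exists s B, A = box s B] `<=` H.
  by move=> _ [s [B ->]]; exact: Hbox.
have lH : lambda_system setT H by split.
apply: (lambda_system_subset setI_closed_box lH GH); first by [].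
move: A mA; apply: smallest_sub; first exact: smallest_sigma_algebra.
move=> _ [x [B ->]]; apply: sub_sigma_algebra.
exists [:: x], (fun=> B); apply/seteqP; split => g /=.
  by move=> Bg y; rewrite inE => /eqP ->.
by apply; rewrite mem_head.
Qed.

End Boxes.

(** * The excess of mass over a finite set *)

Section Excess.
Context {R : realType} {d : nat}.
Variable p : R.

(** The number of sites that a site attracts minus the one site that it is:
    [1 / p - 1] at a head, [-1] elsewhere. *)
Definition step (b : bool) : R := p^-1 * b%:R - 1.

(** The sum of the steps over the sites in [s]; it has mean 0. *)
Definition excess (s : seq (site d)) (g : config d) : R :=
  \sum_(y <- s) step (g y).

(** Expectation of [psi] at the sum of [k] independent steps. *)
Fixpoint walk (k : nat) (psi : R -> R) : R :=
  if k is k'.+1 then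
    p * walk k' (fun x => psi (step true + x)) +
    (1 - p) * walk k' (fun x => psi (step false + x))
  else psi 0.

(** The event that the site [y] has the value [b]. *)
Definition coord (y : site d) (b : bool) : set (config d) := [set g | g y = b].

Lemma measurable_coord y b : measurable (coord y b).
Proof. exact: measurable_coordinate y [set b]. Qed.

Lemma excess_cons y s g : excess (y :: s) g = step (g y) + excess s g.
Proof. by rewrite /excess big_cons. Qed.

Lemma excess_split y s (psi : R -> R) (g : config d) :
  psi (excess (y :: s) g) =
    \1_(coord y true) g * psi (step true + excess s g) +
    \1_(coord y false) g * psi (step false + excess s g).
Proof.
rewrite excess_cons !indicE /coord.
have -> : (g \in [set g : config d | g y = true]) = g y.
  by apply/idP/idP => [/set_mem //|h]; apply/mem_set.
have -> : (g \in [set g : config d | g y = false]) = ~~ g y.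
  by apply/idP/idP => [/set_mem /= ->//|/negbTE h]; apply/mem_set.
by case: (g y) => /=; rewrite mul1r mul0r ?addr0 ?add0r.
Qed.

(** No hypothesis on [psi] is needed, as [excess s] takes finitely many
    values. *)
Lemma bounded_measurable_excess (psi : R -> R) (s : seq (site d)) :
  bounded_measurable (fun g : config d => psi (excess s g)).
Proof.
elim: s psi => [|y s IH] psi.
  rewrite (_ : (fun g => _) = fun=> psi 0); first exact: bounded_measurable_cst.
  by apply/funext => g; rewrite /excess big_nil.
rewrite (funext (excess_split y s psi)).
apply: bounded_measurableD; apply: bounded_measurableM.
- by apply: bounded_measurable_indic; exact: measurable_coord.
- exact: (IH (fun x => psi (step true + x))).
- by apply: bounded_measurable_indic; exact: measurable_coord.
- exact: (IH (fun x => psi (step false + x))).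
Qed.

End Excess.

Section ProductMeasure.
Context {R : realType} {d : nat} {p : R} {mu : probability (config d) R}.
Hypothesis hp : 0 < p < 1.
Hypothesis hmu : is_product_measure p mu.

Lemma bernoulli_prob_set1 b :
  bernoulli_prob p [set b] = (if b then p else 1 - p)%:E.
Proof.
case/andP: hp => p0 p1; rewrite /bernoulli_prob (ltW p0) (ltW p1)/=.
by rewrite fsbig_set1 /bernoulli_pmf; case: b.
Qed.

(** Requiring in addition the value at a new site. *)
Lemma box_coordI (y : site d) t B b : y \notin t ->
  box t B `&` coord y b =
  box (y :: t) (fun x => if x == y then [set b] else B x).
Proof.
move=> yt; rewrite box_cons eqxx setIC; congr (_ `&` _).
apply: eq_box => x xt; case: eqP => // xy.
by move: yt; rewrite -xy xt.
Qed.

Lemma mu_box_coordI (y : site d) t B b : uniq (y :: t) ->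
  fine (mu (box t B `&` coord y b)) =
  (if b then p else 1 - p) * fine (mu (box t B)).
Proof.
move=> u; have /= /andP[yt ut] := u; rewrite box_coordI//.
rewrite [mu (box (y :: t) _)](hmu _ u) big_cons eqxx bernoulli_prob_set1.
rewrite [X in (_ * X)%E](_ : _ = mu (box t B)); last first.
  rewrite [RHS](hmu _ ut) big_seq [RHS]big_seq; apply: eq_bigr => x xt.
  by case: eqP => // xy; move: yt; rewrite -xy xt.
by rewrite fineM// fin_num_measure//; exact: measurable_box.
Qed.

(** The coordinates in [s] are independent of any box over other sites. *)
Lemma mean_box_excess (t : seq (site d)) B s psi : uniq (s ++ t) ->
  mean mu (fun g => \1_(box t B) g * psi (excess p s g)) =
  fine (mu (box t B)) * walk p (size s) psi.
Proof.
elim: s t B psi => [|y s IH] t B psi u.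
  rewrite /= -mean_indic; last exact: measurable_box.
  rewrite mulrC -meanZ;
    last by apply: bounded_measurable_indic; exact: measurable_box.
  congr mean; apply/funext => g; rewrite mulrC; congr (psi _ * _).
  by rewrite /excess big_nil.
have /= /andP[yst ust] := u.
have [ys yt] : y \notin s /\ y \notin t.
  by move: yst; rewrite mem_cat negb_or => /andP[].
have ut : uniq t by move: ust; rewrite cat_uniq => /and3P[].
have bmB b f : bounded_measurable f ->
    bounded_measurable (fun g => \1_(box t B `&` coord y b) g * f g).
  move=> hf; apply: bounded_measurableM => //; apply: bounded_measurable_indic.
  by apply: measurableI; [exact: measurable_box | exact: measurable_coord].
have -> : (fun g => \1_(box t B) g * psi (excess p (y :: s) g)) =
  fun g => \1_(box t B `&` coord y true) g * psi (step p true + excess p s g) +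
           \1_(box t B `&` coord y false) g * psi (step p false + excess p s g).
  apply/funext => g; by rewrite excess_split mulrDr !mulrA !indicI.
have bE b := bounded_measurable_excess p (fun x => psi (step p b + x)) s.
rewrite meanD; [|exact: bmB (bE true)|exact: bmB (bE false)].
have key b : mean mu (fun g => \1_(box t B `&` coord y b) g *
      psi (step p b + excess p s g)) =
    (if b then p else 1 - p) * fine (mu (box t B)) *
      walk p (size s) (fun x => psi (step p b + x)).
  rewrite -(@mu_box_coordI y)//= ?yt// box_coordI//.
  rewrite (IH _ _ (fun x => psi (step p b + x)))//.
  by move: u; rewrite -(cat1s y s) -catA uniq_catCA.
rewrite !key /=; ring.
Qed.

Lemma mean_excess (s : seq (site d)) psi : uniq s ->
  mean mu (fun g => psi (excess p s g)) = walk p (size s) psi.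
Proof.
move=> us; have := @mean_box_excess [::] (fun=> setT) s psi.
rewrite cats0 => /(_ us).
rewrite (_ : box _ _ = setT); last by apply/seteqP; split.
have /= -> := @probability_setT _ _ _ mu.
rewrite mul1r => <-; congr mean; apply/funext => g.
by rewrite indicT mul1r.
Qed.

End ProductMeasure.

(** * Second and fourth moments *)

Section WalkMoments.
Context {R : realType}.
Variable p : R.
Hypothesis hp : 0 < p < 1.

Let p_neq0 : p != 0.
Proof. by case/andP: hp => /lt0r_neq0. Qed.

Lemma stepT : step p true = p^-1 - 1.
Proof. by rewrite /step mulr1. Qed.

Lemma stepF : step p false = - 1.
Proof. by rewrite /step mulr0 sub0r. Qed.

(** The [j]-th moment of a step. *)
Definition moment (j : nat) : R :=
  p * step p true ^+ j + (1 - p) * step p false ^+ j.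

(** The moments are computed for a walk with an arbitrary starting point [c],
    so that the induction on its length closes. *)
Lemma walk_moment1 k (c : R) : walk p k (fun x => c + x) = c.
Proof.
elim: k c => [|k IH] c /=; first by rewrite addr0.
under eq_fun do rewrite addrA.
rewrite IH; under eq_fun do rewrite addrA.
by rewrite IH stepT stepF; field.
Qed.

Lemma walk_moment2 k (c : R) :
  walk p k (fun x => (c + x) ^+ 2) = c ^+ 2 + k%:R * moment 2.
Proof.
elim: k c => [|k IH] c /=; first by rewrite addr0 mul0r addr0.
under eq_fun do rewrite addrA.
rewrite IH; under eq_fun do rewrite addrA.
by rewrite IH /moment stepT stepF -natr1; field.
Qed.

Lemma walk_moment4 k (c : R) :
  walk p k (fun x => (c + x) ^+ 4) =
  c ^+ 4 + 6 * c ^+ 2 * (k%:R * moment 2) + 4 * c * (k%:R * moment 3)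
  + k%:R * moment 4 + 3 * k%:R * (k%:R - 1) * moment 2 ^+ 2.
Proof.
elim: k c => [|k IH] c /=; first by rewrite addr0; ring.
under eq_fun do rewrite addrA.
rewrite IH; under eq_fun do rewrite addrA.
by rewrite IH /moment stepT stepF -natr1; field.
Qed.

Lemma moment2_gt0 : 0 < moment 2.
Proof.
case/andP: hp => p0 p1; rewrite /moment stepT stepF.
have := sqr_ge0 (p^-1 - 1); nra.
Qed.

Lemma moment4_ge0 : 0 <= moment 4.
Proof.
case/andP: hp => p0 p1; have h x : 0 <= x ^+ 4 :> R by rewrite exprn_even_ge0.
by rewrite /moment addr_ge0// mulr_ge0// ltW// subr_gt0.
Qed.

End WalkMoments.

Section Clamp.
Context {R : realType}.
Implicit Types x y : R.

(** Truncation to [-1, 1]. *)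
Definition clamp x : R := Num.max (Num.min x 1) (- 1).

Lemma clamp_norm_le1 x : `|clamp x| <= 1.
Proof.
have h : (- 1 : R) <= 1 by lra.
by rewrite ler_norml /clamp le_max ge_max ge_min !lexx h !orbT.
Qed.

Lemma clamp_lipschitz x y : `|clamp x - clamp y| <= `|x - y|.
Proof.
wlog: x y / y <= x => [H|yx].
  by case/orP: (le_total y x) => h; [exact: H | rewrite distrC [leRHS]distrC H].
rewrite [leRHS]ger0_norm ?subr_ge0// ler_norml /clamp /Order.max /Order.min.
by do ! case: ifPn; rewrite -?leNgt => *; lra.
Qed.

Lemma clamp_mul_ge x : x ^+ 2 - x ^+ 4 <= x * clamp x.
Proof.
have e : x ^+ 4 = x ^+ 2 * x ^+ 2 by ring.
have [x1|x1] := leP x 1; last first.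
  rewrite /clamp min_r ?max_l; [|lra..].
  rewrite e; nra.
have [x0|x0] := leP (-1) x; last first.
  rewrite /clamp min_l ?max_r; [|lra..].
  rewrite e; nra.
rewrite /clamp min_l ?max_l//; have := sqr_ge0 (x ^+ 2); rewrite e; nra.
Qed.

End Clamp.

Section Fluctuation.
Context {R : realType} {d : nat} {p : R} {mu : probability (config d) R}.
Hypothesis hp : 0 < p < 1.
Hypothesis hmu : is_product_measure p mu.

Lemma mean_excess0 (s : seq (site d)) : uniq s -> mean mu (excess p s) = 0.
Proof.
move=> us; have := mean_excess hp hmu (fun x => 0 + x) us.
rewrite walk_moment1// => <-.
by congr mean; apply/funext => g; rewrite add0r.
Qed.

Lemma bounded_measurable_excess_id (s : seq (site d)) :
  bounded_measurable (excess p s).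
Proof. exact: (bounded_measurable_excess p id s). Qed.

(** The excess of mass over [N] sites is typically of order [sqrt N]: its
    covariance with a truncation at that scale is at least [delta * sqrt N]. *)
Lemma excess_clamp_lower : exists c delta : R, [/\ 0 < c, 0 < delta &
  forall (s : seq (site d)) (r : R), uniq s -> 0 < r -> r ^+ 2 = (size s)%:R ->
    delta * r <=
      mean mu (fun g => excess p s g * clamp (c / r * excess p s g))].
Proof.
have m2 := moment2_gt0 hp; have m4 := moment4_ge0 hp.
set v := moment p 2 in m2 *; set m := moment p 4 in m4 *.
(* [M] bounds the fourth moment divided by [N ^ 2]; the term [v] makes [c <= 1],
   and [c] is such that the fourth moment eats at most half of the second *)
pose M := m + 3 * v ^+ 2 + v + 1.
have M0 : 0 < M by rewrite /M; have := sqr_ge0 v; lra.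
pose c := v / (2 * M).
have c0 : 0 < c by rewrite divr_gt0// mulr_gt0.
have cM : c * M = v / 2 by rewrite /c; field; rewrite gt_eqF.
have c1 : c <= 1.
  rewrite /c ler_pdivrMr ?mulr_gt0// mul1r /M; have := sqr_ge0 v; lra.
exists c, (c * v / 2); split; [by []|by rewrite divr_gt0// mulr_gt0|].
move=> s r us r0 rs; set th := c / r.
have th0 : 0 < th by rewrite divr_gt0.
set N := (size s)%:R in rs *.
have bE psi := bounded_measurable_excess p psi s.
have E2 : mean mu (fun g => excess p s g ^+ 2) = N * v.
  have := mean_excess hp hmu (fun x => (0 + x) ^+ 2) us.
  rewrite walk_moment2// expr0n add0r => <-.
  by congr mean; apply/funext => g; rewrite add0r.
have E4 : mean mu (fun g => excess p s g ^+ 4) <= N ^+ 2 * M.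
  have := mean_excess hp hmu (fun x => (0 + x) ^+ 4) us.
  rewrite walk_moment4//.
  rewrite (_ : (fun g => (0 + excess p s g) ^+ 4) = fun g => excess p s g ^+ 4);
    last by apply/funext => g; rewrite add0r.
  move=> ->; rewrite -/N -/v -/m.
  have N0 : 0 <= N by exact: ler0n.
  have NN : N <= N ^+ 2.
    rewrite /N -natrX ler_nat; case: (size s) => // k.
    by rewrite expnS expn1 leq_pmulr.
  have v2 := sqr_ge0 v; rewrite /M.
  have := ler_wpM2r m4 NN.
  have N2 := sqr_ge0 N; nra.
have key : th ^+ 2 * (N * v) - th ^+ 4 * (N ^+ 2 * M) <=
    th * mean mu (fun g => excess p s g * clamp (th * excess p s g)).
  rewrite -meanZ; last exact: (bE (fun x => x * clamp (th * x))).
  apply: (@le_trans _ _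
    (mean mu (fun g =>
      th ^+ 2 * excess p s g ^+ 2 - th ^+ 4 * excess p s g ^+ 4))).
    rewrite meanB; [|exact: (bE (fun x => th ^+ 2 * x ^+ 2))
                    |exact: (bE (fun x => th ^+ 4 * x ^+ 4))].
    rewrite !meanZ; [|exact: (bE (fun x => x ^+ 4))
                     |exact: (bE (fun x => x ^+ 2))].
    by rewrite E2 lerB// ler_wpM2l// exprn_even_ge0.
  apply: le_mean.
  - exact: (bE (fun x => th ^+ 2 * x ^+ 2 - th ^+ 4 * x ^+ 4)).
  - exact: (bE (fun x => th * (x * clamp (th * x)))).
  - by move=> g; rewrite mulrA -!exprMn; exact: clamp_mul_ge.
rewrite -(ler_pM2l th0); apply: le_trans key.
have -> : th ^+ 2 * (N * v) = c ^+ 2 * v.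
  by rewrite /th -rs; field; rewrite gt_eqF.
have -> : th ^+ 4 * (N ^+ 2 * M) = c ^+ 3 * (c * M).
  by rewrite /th -rs; field; rewrite gt_eqF.
have -> : th * (c * v / 2 * r) = c ^+ 2 * v / 2.
  by rewrite /th; field; rewrite gt_eqF.
rewrite cM; have c2 : 0 < c ^+ 2 by rewrite exprn_gt0.
have : c ^+ 3 <= c ^+ 2 by rewrite exprS ger_pMl.
nra.
Qed.

End Fluctuation.

(** * Shift invariance and mixing *)

Section Shift.
Context {R : realType} {d : nat} {p : R} {mu : probability (config d) R}.
Hypothesis hmu : is_product_measure p mu.

Lemma preimage_shift_box (x : site d) s B :
  shift_config x @^-1` (box s B) =
  box [seq y - x | y <- s] (fun z => B (z + x)).
Proof.
apply/seteqP; split=> g /= h y.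
  by move=> /mapP[z zs ->]; rewrite subrK; exact: h.
move=> ys; have := h (y - x); rewrite subrK; apply.
by apply/mapP; exists y.
Qed.

Lemma preimage_shiftD (x : site d) (A B : set (config d)) :
  shift_config x @^-1` (A `\` B) =
  shift_config x @^-1` A `\` shift_config x @^-1` B.
Proof. by []. Qed.

Lemma measurable_shift (x : site d) (A : set (config d)) : measurable A ->
  measurable (shift_config x @^-1` A).
Proof.
apply: (box_dynkin (H := fun A => measurable (shift_config x @^-1` A))).
- by move=> s B; rewrite preimage_shift_box; exact: measurable_box.
- by move=> C D _ mC mD; rewrite preimage_shiftD; exact: measurableD.
- by move=> F _ mF; rewrite preimage_bigcup; exact: bigcupT_measurable.
Qed.

Lemma mu_shift (x : site d) (A : set (config d)) : measurable A ->
  mu (shift_config x @^-1` A) = mu A.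
Proof.
move=> mA.
suff [] : measurable A /\ mu (shift_config x @^-1` A) = mu A by [].
apply: (box_dynkin (H := fun A : set (config d) =>
  measurable A /\ mu (shift_config x @^-1` A) = mu A)) mA.
- move=> s B; split; first exact: measurable_box.
  rewrite preimage_shift_box -box_undup -[in RHS]box_undup.
  rewrite undup_map_inj; last exact: addIr.
  rewrite [LHS](hmu _ _) ?map_inj_uniq ?undup_uniq//; last exact: addIr.
  rewrite [RHS](hmu _ (undup_uniq _)) big_map.
  by apply: eq_bigr => y _; rewrite subrK.
- move=> C D DC [mC hC] [mD hD]; split; first exact: measurableD.
  have muD (A' B' : set (config d)) : measurable A' -> measurable B' ->
      B' `<=` A' -> mu (A' `\` B') = (mu A' - mu B')%E.
    move=> mA' mB' BA; rewrite measureD// ?setIidr//.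
    by rewrite ltey_eq fin_num_measure.
  have mC' := measurable_shift x mC; have mD' := measurable_shift x mD.
  have DC' : shift_config x @^-1` D `<=` shift_config x @^-1` C.
    by move=> g; exact: DC.
  by rewrite preimage_shiftD (muD _ _ mC' mD' DC') (muD _ _ mC mD DC) hC hD.
- move=> F ndF hF; have mF i : measurable (F i) by have [] := hF i.
  split; first exact: bigcupT_measurable.
  have h1 := @nondecreasing_cvg_mu _ _ _ mu F mF (bigcupT_measurable _ mF) ndF.
  have mG i : measurable (shift_config x @^-1` F i) by exact: measurable_shift.
  have ndG : nondecreasing_seq (fun i => shift_config x @^-1` F i).
    move=> i j ij; apply/subsetPset => g /=.
    exact: (subsetPset _ _ (ndF i j ij)).
  have h2 := @nondecreasing_cvg_mu _ _ _ mu _ mG (bigcupT_measurable _ mG) ndG.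
  rewrite preimage_bigcup -(cvg_lim _ h1)// -(cvg_lim _ h2)//.
  by apply: congr_lim; apply/funext => i /=; have [] := hF i.
Qed.

End Shift.

Section Mixing.
Context {R : realType} {d : nat} {p : R} {mu : probability (config d) R}.
Hypothesis hp : 0 < p < 1.
Hypothesis hmu : is_product_measure p mu.

(** Truncated excess, at scale [1 / th], and centred. *)
Definition probe (th : R) (s : seq (site d)) (g : config d) : R :=
  clamp (th * excess p s g) - mean mu (fun g => clamp (th * excess p s g)).

Lemma bounded_measurable_probe th s : bounded_measurable (probe th s).
Proof.
exact: (bounded_measurable_excess p
  (fun x => clamp (th * x) - mean mu (fun g => clamp (th * excess p s g))) s).
Qed.

Lemma bounded_measurable_clamp th (s : seq (site d)) :
  bounded_measurable (fun g => clamp (th * excess p s g)).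
Proof. exact: (bounded_measurable_excess p (fun x => clamp (th * x)) s). Qed.

Lemma probe_le2 th s g : `|probe th s g| <= 2.
Proof.
rewrite (le_trans (ler_normB _ _))// (_ : 2 = 1 + 1)// lerD ?clamp_norm_le1//.
apply: mean_norm_le; first exact: bounded_measurable_clamp.
by move=> x; exact: clamp_norm_le1.
Qed.

(** Asymptotic independence of the event [A] and the centred truncated excess
    of any finite set, at large scales, uniformly over the translates of [A]. *)
Definition mixing (A : set (config d)) : Prop :=
  forall e : R, 0 < e -> exists2 eta : R, 0 < eta &
    forall th, 0 < th <= eta -> forall s : seq (site d), uniq s ->
    forall x : site d,
      `|mean mu (fun g => \1_(shift_config x @^-1` A) g * probe th s g)| <= e.

Lemma step_norm_le b : `|step p b| <= p^-1.
Proof.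
case/andP: hp => p0 p1; have pV : 1 <= p^-1 by rewrite invf_ge1// ltW.
case: b; rewrite ?stepT ?stepF.
  by rewrite ger0_norm ?subr_ge0// gerBl.
by rewrite normrN normr1.
Qed.

Lemma excess_norm_le (s : seq (site d)) g :
  `|excess p s g| <= (size s)%:R * p^-1.
Proof.
elim: s => [|y s IH]; first by rewrite /excess big_nil normr0 mul0r.
rewrite excess_cons (le_trans (ler_normD _ _))//= -natr1 mulrDl mul1r addrC.
by rewrite lerD// step_norm_le.
Qed.

Lemma excess_filter (a : pred (site d)) s g : excess p s g =
  excess p (seq.filter a s) g + excess p (seq.filter (predC a) s) g.
Proof. by rewrite /excess !big_filter (bigID a)/=. Qed.

(** A box over [t] is independent of the excess outside [t], and the excess
    carried by [t] is at most [size t / p]. *)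
Lemma mean_box_probe t B th s : 0 < th -> uniq s ->
  `|mean mu (fun g => \1_(box t B) g * probe th s g)|
    <= 2 * (th * ((size t)%:R * p^-1)).
Proof.
move=> th0 us; case/andP: (hp) => p0 p1.
rewrite -box_undup.
set t' := undup t; set A := box t' B.
have mA : measurable A := measurable_box _ _.
have bA : bounded_measurable (\1_A : config d -> R).
  exact: bounded_measurable_indic.
set s1 := seq.filter (predC (mem t')) s; set s2 := seq.filter (mem t') s.
have us1 : uniq s1 by exact: filter_uniq.
have szs2 : (size s2 <= size t)%N.
  apply: leq_trans (size_undup t); apply: uniq_leq_size.
    exact: filter_uniq.
  by move=> y; rewrite mem_filter => /andP[].
have bc := bounded_measurable_clamp th.
pose e := th * ((size t)%:R * p^-1).
have close g : `|clamp (th * excess p s g) - clamp (th * excess p s1 g)| <= e.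
  rewrite (le_trans (clamp_lipschitz _ _))// -mulrBr (excess_filter (mem t')).
  rewrite -/s2 -/s1 addrK normrM gtr0_norm// ler_pM2l//.
  rewrite (le_trans (excess_norm_le _ _))// ler_pM2r ?invr_gt0//.
  by rewrite ler_nat.
set m := mean mu (fun g => clamp (th * excess p s g)).
set m1 := mean mu (fun g => clamp (th * excess p s1 g)).
have -> : mean mu (fun g => \1_A g * probe th s g) =
  mean mu (fun g =>
    \1_A g * (clamp (th * excess p s g) - clamp (th * excess p s1 g)))
  + mean mu \1_A * (m1 - m).
  have e1 : mean mu (fun g => \1_A g * clamp (th * excess p s1 g)) =
      mean mu \1_A * m1.
    rewrite (mean_box_excess hp hmu B (fun x => clamp (th * x))); last first.
      rewrite cat_uniq us1 undup_uniq andbT/=; apply/hasPn => y yt.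
      by rewrite /= mem_filter/= yt.
    by rewrite mean_indic// /m1 (mean_excess hp hmu (fun x => clamp (th * x))).
  have b1 := bounded_measurableM bA (bc s1).
  have b2 := bounded_measurableM bA (bounded_measurableB (bc s) (bc s1)).
  have b3 := bounded_measurableZ m bA.
  rewrite mulrBr -e1 (mulrC _ m) -(meanZ mu m bA) addrA -meanD// -meanB//;
    last exact: bounded_measurableD.
  by congr mean; apply/funext => g; rewrite /probe -/m; ring.
rewrite (le_trans (ler_normD _ _))// (_ : 2 * _ = e + e);
  last by rewrite /e; ring.
apply: lerD.
  apply: mean_norm_le.
    by apply: bounded_measurableM => //; exact: bounded_measurableB.
  move=> g; rewrite normrM indicE; case: (g \in A) => /=.
    by rewrite normr1 mul1r.
  by rewrite normr0 mul0r /e !mulr_ge0 ?invr_ge0 ?ler0n ?(ltW th0) ?(ltW p0).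
rewrite normrM -[e]mul1r ler_pM//.
  apply: mean_norm_le => // g; rewrite indicE; case: (g \in A) => /=.
    by rewrite normr1.
  by rewrite normr0.
rewrite distrC /m /m1 -meanB//; apply: mean_norm_le => //.
exact: bounded_measurableB.
Qed.

Lemma mean_shift_indic (x : site d) (A : set (config d)) : measurable A ->
  mean mu \1_(shift_config x @^-1` A) = fine (mu A).
Proof.
by move=> mA; rewrite mean_indic ?(mu_shift hmu)//; exact: measurable_shift.
Qed.

Lemma bounded_measurable_shift_indic (x : site d) (A : set (config d)) :
  measurable A ->
  bounded_measurable (\1_(shift_config x @^-1` A) : config d -> R).
Proof.
by move=> mA; apply: bounded_measurable_indic; exact: measurable_shift.
Qed.

Lemma indic_setD_sub {T : Type} (A B : set T) x : B `<=` A ->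
  \1_(A `\` B) x = \1_A x - \1_B x :> R.
Proof.
move=> BA; rewrite !indicE in_setD; have [xB|xB] := boolP (x \in B).
  by rewrite (mem_set (BA _ (set_mem xB))) subrr.
by rewrite andbT subr0.
Qed.

(** The mixing events form a lambda-system: by shift invariance, an event and
    an approximation of it have close covariances with the probe, uniformly
    over translates. *)
Lemma mixing_measurable (A : set (config d)) : measurable A -> mixing A.
Proof.
move=> mA; suff [] : measurable A /\ mixing A by [].
have bp := bounded_measurable_probe.
apply: (box_dynkin
  (H := fun A : set (config d) => measurable A /\ mixing A)) mA.
- move=> t B; split=> [|e e0]; first exact: measurable_box.
  case/andP: (hp) => p0 p1; have t0 : 0 < (size t).+1%:R :> R by rewrite ltr0n.
  exists (e * p / (2 * (size t).+1%:R)); first by rewrite divr_gt0 ?mulr_gt0.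
  move=> th /andP[th0 the] s us x; rewrite preimage_shift_box.
  rewrite (le_trans (mean_box_probe _ _ th0 us))// size_map.
  move: the; rewrite ler_pdivlMr ?mulr_gt0// -ler_pdivrMr// => the.
  apply: le_trans the; rewrite -[leRHS]mulrA mulrA [2 * th]mulrC -!mulrA.
  rewrite ler_pM2l// ler_pM2l// ler_pM2r ?invr_gt0//.
  by rewrite ler_nat.
- move=> C D DC [mC hC] [mD hD]; split=> [|e e0]; first exact: measurableD.
  have e20 : 0 < e / 2 by rewrite divr_gt0.
  have [eC eC0 HC] := hC _ e20; have [eD eD0 HD] := hD _ e20.
  exists (Num.min eC eD); first by rewrite lt_min eC0.
  move=> th /andP[th0]; rewrite le_min => /andP[thC thD] s us x.
  have -> : mean mu (fun g =>
        \1_(shift_config x @^-1` (C `\` D)) g * probe th s g) =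
      mean mu (fun g => \1_(shift_config x @^-1` C) g * probe th s g) -
      mean mu (fun g => \1_(shift_config x @^-1` D) g * probe th s g).
    rewrite -meanB; [|by apply: bounded_measurableM => //;
                       exact: bounded_measurable_shift_indic..].
    congr mean; apply/funext => g.
    rewrite -mulrBl preimage_shiftD indic_setD_sub//.
    by move=> h; exact: DC.
  rewrite (le_trans (ler_normB _ _))// (splitr e) lerD//.
    by apply: HC => //; rewrite th0.
  by apply: HD => //; rewrite th0.
- move=> F ndF hF; have mF i : measurable (F i) by have [] := hF i.
  have mU : measurable (\bigcup_i F i) by exact: bigcupT_measurable.
  split=> // e e0.
  have e20 : 0 < e / 2 by rewrite divr_gt0.
  have e40 : 0 < e / 4 by rewrite divr_gt0.
  have [m hm] := ndseq_mass mu ndF mF e40.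
  have [eta eta0 H] := (hF m).2 _ e20.
  exists eta => // th thE s us x; have := H th thE s us x.
  set U := \bigcup_i F i in mU hm *.
  have bU := bounded_measurable_shift_indic x mU.
  have bF := bounded_measurable_shift_indic x (mF m).
  have -> : mean mu (fun g => \1_(shift_config x @^-1` U) g * probe th s g) =
      mean mu (fun g => (\1_(shift_config x @^-1` U) g -
        \1_(shift_config x @^-1` F m) g) * probe th s g) +
      mean mu (fun g => \1_(shift_config x @^-1` F m) g * probe th s g).
    rewrite -meanD; [|apply: bounded_measurableM => //;
                      exact: bounded_measurableB|exact: bounded_measurableM].
    by congr mean; apply/funext => g; rewrite -mulrDl subrK.
  move=> h; rewrite (le_trans (ler_normD _ _))// (splitr e) lerD//.
  apply: (@le_trans _ _ (2 * mean mu (fun g => \1_(shift_config x @^-1` U) g -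
        \1_(shift_config x @^-1` F m) g))).
    apply: mean_mul_le => //; first exact: bounded_measurableB.
      apply: aeW => g; rewrite -indic_setD_sub; first by rewrite indicE.
      by move=> g' ?; exists m.
    by move=> g; exact: probe_le2.
  rewrite meanB// !mean_shift_indic//; lra.
Qed.

End Mixing.

(** * The boundary of a cube *)

Section Cube.
Context {d : nat}.

(** The site with coordinates [f]. *)
Definition coord_site {n : nat} (f : {ffun 'I_d -> 'I_n}) : site d :=
  \row_i (f i)%:Z.

(** The sites with all coordinates in [0, n). *)
Definition cube (n : nat) : seq (site d) :=
  [seq coord_site f | f : {ffun 'I_d -> 'I_n}].

Lemma coord_site_inj n : injective (@coord_site n).
Proof.
move=> f g /rowP fg; apply/ffunP => i; apply/val_inj.
by have := fg i; rewrite !mxE => -[].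
Qed.

Lemma cube_uniq n : uniq (cube n).
Proof. by rewrite map_inj_uniq ?enum_uniq//; exact: coord_site_inj. Qed.

Lemma size_cube n : size (cube n) = (n ^ d)%N.
Proof. by rewrite size_map -cardE card_ffun !card_ord. Qed.

Lemma mem_cube n (x : site d) :
  (x \in cube n) = [forall i, (0 <= x 0 i) && (x 0 i < n%:Z)].
Proof.
apply/idP/forallP => [/mapP[f _ ->] i|h].
  by rewrite mxE /= ltz_nat ltn_ord.
have lt i : (`|x 0%R i| < n)%N.
  by have /andP[h0 h1] := h i; rewrite -ltz_nat gez0_abs.
apply/mapP; exists [ffun i => Ordinal (lt i)]; first by rewrite mem_enum.
apply/rowP => i; rewrite mxE ffunE /=; have /andP[h0 _] := h i.
by rewrite gez0_abs.
Qed.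

(** The sites of the cube which leave it under translation by [v]. *)
Definition exits n (v : site d) : seq (site d) :=
  [seq y <- cube n | y + v \notin cube n].

(** At most [|w|] points of an interval leave it under translation by [w]. *)
Lemma card_escape n (w : int) :
  (#|[pred a : 'I_n | ~~ ((0 <= a%:Z + w) && (a%:Z + w < n%:Z))%R]|
     <= minn n `|w|)%N.
Proof.
set J := [pred a : 'I_n | _].
rewrite leq_min; apply/andP; split; first by rewrite -[leqRHS]card_ord max_card.
pose t := if 0 <= w then iota (n - `|w|) `|w| else iota 0 `|w|.
have -> : `|w|%N = size t by rewrite /t; case: ifP => _; rewrite size_iota.
rewrite cardE -(size_map val); apply: uniq_leq_size.
  by rewrite map_inj_uniq ?enum_uniq//; exact: val_inj.
move=> _ /mapP[a + ->]; rewrite mem_enum inE /t => aJ.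
have := ltn_ord a; move: aJ; case: ifP => w0 aJ an; rewrite mem_iota
  -[\val a]/(nat_of_ord a); lia.
Qed.

Lemma card_coordinate_in n (i : 'I_d) (J : pred 'I_n) :
  #|[pred f : {ffun 'I_d -> 'I_n} | J (f i)]| = (#|J| * n ^ d.-1)%N.
Proof.
pose F (j : 'I_d) : pred 'I_n := if j == i then J else predT.
rewrite (eq_card (B := family F)); last first.
  move=> f; rewrite inE; apply/idP/familyP => [Jf j|/(_ i)].
    by rewrite /F; case: eqP => [->|_].
  by rewrite /F eqxx.
rewrite card_family foldrE big_map big_enum (bigD1 i)//= /F eqxx; congr muln.
rewrite (eq_bigr (fun=> n)) => [|j /negbTE ->]; last by rewrite card_ord.
by rewrite prod_nat_const cardC1 card_ord.
Qed.

Lemma size_exits n (v : site d) :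
  (size (exits n v) <= \sum_(i < d) minn n `|v 0%R i| * n ^ d.-1)%N.
Proof.
pose J (i : 'I_d) : pred 'I_n :=
  [pred a : 'I_n | ~~ ((0 <= a%:Z + v 0%R i) && (a%:Z + v 0%R i < n%:Z))%R].
apply: (@leq_trans
  (\sum_(i < d) #|[pred f : {ffun 'I_d -> 'I_n} | J i (f i)]|)).
  rewrite /exits /cube filter_map size_map size_filter.
  rewrite -sum1_count big_enum_cond /=.
  under [leqRHS]eq_bigr do rewrite -sum1_card.
  rewrite (exchange_big_dep predT)//= big_mkcond/=; apply: leq_sum => f _.
  case: ifP => // h.
  have : ~~ (coord_site f + v \in cube n) by [].
  rewrite mem_cube => /forallPn[i].
  rewrite !mxE => hi; rewrite sum1_card; apply/card_gt0P; exists i.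
  exact: hi.
apply: leq_sum => i _; rewrite card_coordinate_in leq_mul2r.
by rewrite card_escape orbT.
Qed.

(** Summing a function over the cube and over its translate gives the same
    result up to the sites crossing the boundary. *)
Lemma sum_exits {R : realType} n (v : site d) (u : site d -> R) (e : R) :
  (forall x, `|u x| <= e) ->
  `|\sum_(y <- cube n) u (y - v) - \sum_(y <- cube n) u y|
    <= ((size (exits n (- v)))%:R + (size (exits n v))%:R) * e.
Proof.
move=> ue.
rewrite (bigID (fun y => y - v \in cube n))/=.
rewrite [X in _ - X](bigID (fun y => y + v \in cube n))/=.
have -> : \sum_(y <- cube n | y - v \in cube n) u (y - v) =
    \sum_(y <- cube n | y + v \in cube n) u y.
  rewrite -big_filter -[RHS]big_filter -(big_map (fun y => y - v) xpredT u).
  apply: perm_big; apply: uniq_perm.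
  - by rewrite map_inj_uniq ?filter_uniq ?cube_uniq//; exact: addIr.
  - by rewrite filter_uniq ?cube_uniq.
  move=> z; rewrite mem_filter; apply/mapP/andP => [[y]|[h1 h2]].
    by rewrite mem_filter => /andP[h1 h2] ->; rewrite subrK.
  by exists (z + v); rewrite ?addrK// mem_filter addrK h1 h2.
have sum_le (s : seq (site d)) (f : site d -> site d) :
    `|\sum_(y <- s) u (f y)| <= (size s)%:R * e.
  rewrite (le_trans (ler_norm_sum _ _ _))//.
  rewrite (le_trans (ler_sum _ (fun i _ => ue _)))//.
  by rewrite big_const_seq count_predT iter_addr_0 mulr_natl.
rewrite opprD addrACA subrr add0r mulrDl (le_trans (ler_normB _ _))// lerD//.
  by rewrite -big_filter; exact: (sum_le _ (fun y => y - v)).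
by rewrite -big_filter; exact: (sum_le _ id).
Qed.

End Cube.

Section Norm.
Context {R : realType} {d : nat}.

Lemma enorm_ge0 (v : site d) : 0 <= enorm R v.
Proof. exact: sqrtr_ge0. Qed.

Lemma enormN (v : site d) : enorm R (- v) = enorm R v.
Proof.
rewrite /enorm; congr Num.sqrt; apply: eq_bigr => i _.
by rewrite mxE rmorphN sqrrN.
Qed.

Lemma coordinate_le_enorm (v : site d) i : `|v 0%R i|%N%:R <= enorm R v.
Proof.
rewrite -(@ler_sqr R) ?nnegrE ?enorm_ge0// sqr_sqrtr; last first.
  by apply: sumr_ge0 => j _; exact: sqr_ge0.
rewrite (bigD1 i)//=.
have -> : (`|v 0%R i|%N)%:R ^+ 2 = (v 0 i)%:~R ^+ 2 :> R.
  by rewrite pmulrn abszE intr_norm real_normK// num_real.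
by rewrite lerDl; apply: sumr_ge0 => j _; exact: sqr_ge0.
Qed.

Lemma powR_half_sqr (v : site d) :
  (enorm R v `^ (d%:R / 2)) ^+ 2 = enorm R v ^+ d.
Proof.
rewrite -powR_mulrn ?powR_ge0// -powRrM -[RHS]powR_mulrn ?enorm_ge0//.
by congr (_ `^ _); field.
Qed.

(** The only place where the dimension matters. Each coordinate [i] accounts
    for at most [n ^ (d - 1) * min n |v_i|] sites. For [d = 1] this is at most
    the square root of [n * |v|], for [d = 2] at most [n * |v|]; in both cases
    it is [n ^ (d / 2) * |v| ^ (d / 2)]. *)
Lemma size_exits_le (n : nat) (r : R) (v : site d) : d = 1%N \/ d = 2%N ->
  0 < r -> r ^+ 2 = (n ^ d)%:R ->
  (size (exits n v))%:R <= 2 * r * enorm R v `^ (d%:R / 2).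
Proof.
move=> hd r0 rn; set h := enorm R v `^ _.
have h0 : 0 <= h by exact: powR_ge0.
have h2 : h ^+ 2 = enorm R v ^+ d by exact: powR_half_sqr.
apply: (@le_trans _ _ (\sum_(i < d) r * h)); last first.
  rewrite sumr_const card_ord -[2 * r * h]mulrA -[leLHS]mulr_natl.
  rewrite ler_wpM2r ?mulr_ge0 ?(ltW r0)//.
  by case: hd => ->; rewrite ler_nat.
apply: (@le_trans _ _ (\sum_(i < d) (minn n `|v 0%R i| * n ^ d.-1)%:R)).
  by rewrite -natr_sum ler_nat size_exits.
apply: ler_sum => i _.
rewrite -(@ler_sqr R) ?nnegrE// ?mulr_ge0 ?(ltW r0)//.
rewrite exprMn rn h2.
have hm1 : (minn n `|v 0%R i|)%:R <= n%:R :> R by rewrite ler_nat geq_minl.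
have hm2 : (minn n `|v 0%R i|)%:R <= enorm R v.
  by rewrite (le_trans _ (coordinate_le_enorm v i))// ler_nat geq_minr.
have n0 : 0 <= n%:R :> R by [].
move: hm1 hm2 n0; rewrite natrM exprMn !natrX.
have : 0 <= (minn n `|v 0%R i|)%:R :> R by [].
move: (minn n _)%:R n%:R (enorm R v) (enorm_ge0 v) => m N V.
move=> V0 m0 mN mV N0; case: hd => -> /=.
  by rewrite expr0 expr1n mulr1 !expr1 expr2 ler_pM.
by rewrite expr1 mulrC ler_wpM2l ?sqr_ge0// !expr2 ler_pM.
Qed.

End Norm.

(** * Mass transport *)

Section FiniteSums.
Context {R : realType} {T : choiceType}.
Implicit Types (f : T -> R) (V W : seq T).

(** At most one term of the sum is nonzero. *)
Lemma sum_pick_le f V (o : option T) (b : R) : uniq V -> 0 <= b ->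
  (forall v, o = Some v -> f v <= b) ->
  \sum_(v <- V) f v * (o == Some v)%:R <= b.
Proof.
move=> uV b0 fb; case: o fb => [u|] fb; last first.
  by rewrite big1// => v _; rewrite mulr0.
have [uV'|uV'] := boolP (u \in V); last first.
  rewrite big_seq big1// => v vV; rewrite (_ : _ == _ = false) ?mulr0//.
  by apply/eqP => -[e]; rewrite e vV in uV'.
rewrite (bigD1_seq u)//= eqxx mulr1 big1 ?addr0; first exact: fb.
move=> v vu; rewrite (_ : _ == _ = false) ?mulr0//.
by apply/eqP => -[e]; rewrite e eqxx in vu.
Qed.

(** A family of nonnegative reals whose finite sums are bounded has small
    tails. *)
Lemma bounded_sums_tail f (H e : R) : (forall v, 0 <= f v) ->
  (forall V, uniq V -> \sum_(v <- V) f v <= H) -> 0 < e ->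
  exists2 V0, uniq V0 &
    forall W, uniq (V0 ++ W) -> \sum_(v <- W) f v <= e.
Proof.
move=> f0 fH e0.
pose S := [set x : R | exists2 V, uniq V & x = \sum_(v <- V) f v].
have supS : has_sup S.
  split; first by exists 0, [::] => //; rewrite big_nil.
  by exists H => _ [V uV ->]; exact: fH.
have [_ [V0 uV0 ->] h] := sup_adherent e0 supS.
exists V0 => // W uW; have : \sum_(v <- V0 ++ W) f v <= sup S.
  by apply: ub_le_sup; [exact: supS.2|exists (V0 ++ W)].
rewrite big_cat/=; move: h; lra.
Qed.

Lemma counting_size_le (A : set T) (W : seq T) (c : R) : uniq W ->
  (forall x, x \in W -> A x) -> counting A = c%:E -> (size W)%:R <= c.
Proof.
move=> uW WA; rewrite /counting; case: ifPn => // /asboolP fA [<-].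
rewrite ler_nat; apply: uniq_leq_size => // x xW.
by rewrite in_fset_set// inE; exact: WA.
Qed.

End FiniteSums.

Section Transport.
Context {R : realType} {d : nat} {p : R} {mu : probability (config d) R}.
Hypothesis hp : 0 < p < 1.
Hypothesis hmu : is_product_measure p mu.
Variable Phi : config d -> site d -> option (site d).
Hypothesis hPhi : balanced_allocation_rule p mu Phi.

(** The event that the site [x] is allocated to [x + v]. *)
Definition moves (x v : site d) : set (config d) :=
  [set g | Phi g x = Some (x + v)].

(** The probability of the displacement [v], the same at every site. *)
Definition move_prob (v : site d) : R := fine (mu (moves 0 v)).

Lemma measurable_moves x v : measurable (moves x v).
Proof. exact: (bar_measurable hPhi x [set Some (x + v)]). Qed.

Lemma indic_moves x v g : \1_(moves x v) g = (Phi g x == Some (x + v))%:R :> R.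
Proof.
by rewrite indicE; congr (nat_of_bool _)%:R; apply/idP/eqP => [/set_mem|h];
  [|apply/mem_set].
Qed.

Lemma bounded_measurable_moves x v :
  bounded_measurable (\1_(moves x v) : config d -> R).
Proof. by apply: bounded_measurable_indic; exact: measurable_moves. Qed.

Lemma moves_shift x v : moves x v = shift_config (- x) @^-1` moves 0 v.
Proof.
apply/seteqP; split=> g /= h; rewrite /moves /=.
  by have := bar_equivariant hPhi h (- x); rewrite subrr addrAC subrr.
have := bar_equivariant hPhi h x; rewrite !add0r addrC.
by rewrite (_ : shift_config x _ = g)//; apply/funext => y;
  rewrite /shift_config opprK subrK.
Qed.

Lemma mean_moves x v : mean mu \1_(moves x v) = move_prob v.
Proof.
by rewrite moves_shift (mean_shift_indic hmu)//; exact: measurable_moves.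
Qed.

Lemma move_prob_ge0 v : 0 <= move_prob v.
Proof. exact: fine_ge0. Qed.

(** Displacements outside a large finite set are improbable. *)
Lemma move_prob_exhaust (V0 : seq (site d)) (e : R) : uniq V0 -> 0 < e ->
  exists2 W, uniq (V0 ++ W) & 1 - \sum_(v <- V0 ++ W) move_prob v <= e.
Proof.
move=> uV0 e0.
(* [F m]: the displacement of the origin is among the first [m] ones *)
pose F m : set (config d) :=
  [set g | [set o : option (site d) | exists2 v, o = Some v & (pickle v < m)%N]
             (Phi g 0)].
have mF m : measurable (F m) by exact: (bar_measurable hPhi).
have ndF : nondecreasing_seq F.
  move=> i j ij; apply/subsetPset => g [v h vi]; exists v => //.
  exact: leq_trans ij.
have F1 : fine (mu (\bigcup_i F i)) = 1.
  suff -> : mu (\bigcup_i F i) = 1%E by [].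
  have /= <- := @probability_setT _ _ _ mu.
  have mU : measurable (\bigcup_i F i) by exact: bigcupT_measurable.
  rewrite -[LHS]adde0 -[X in (_ + X)%E](_ : mu (~` \bigcup_i F i) = 0%E).
    by rewrite -measureU ?setUv ?setICr//; exact: measurableC.
  have [N [mN N0 hN]] := bar_defined hPhi.
  apply: (subset_measure0 _ mN) => //; first exact: measurableC.
  apply: subset_trans hN => g /= h hd; apply: h.
  have := hd 0; case E : (Phi g 0) => [v|]// _.
  by exists (pickle v).+1 => //; exists v.
have [m] := ndseq_mass mu ndF mF e0; rewrite F1 => hm.
pose Vm : seq (site d) := pmap unpickle (iota 0 m).
pose W := [seq v <- undup Vm | v \notin V0]; exists W.
  rewrite cat_uniq uV0 filter_uniq ?undup_uniq// andbT /=.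
  by apply/hasPn => v; rewrite mem_filter => /andP[].
suff : fine (mu (F m)) <= \sum_(v <- V0 ++ W) move_prob v by lra.
rewrite -mean_indic// (eq_bigr (fun v => mean mu \1_(moves 0 v))); last first.
  by move=> v _; rewrite mean_moves.
rewrite -mean_sum; last by move=> v; exact: bounded_measurable_moves.
apply: le_mean; first exact: bounded_measurable_indic.
  by apply: bounded_measurable_sum => v; exact: bounded_measurable_moves.
move=> g; rewrite [leLHS]indicE.
have [/set_mem [v gv vm]|_] := boolP (g \in F m); last first.
  by apply: sumr_ge0 => v _; rewrite indicE.
have vV : v \in V0 ++ W.
  rewrite mem_cat mem_filter mem_undup; case: (v \in V0) => //=.
  rewrite /Vm mem_pmap; apply/mapP; exists (pickle v); last by rewrite pickleK.
  by rewrite mem_iota.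
rewrite (big_rem v)//= indic_moves gv add0r eqxx lerDl.
by apply: sumr_ge0 => u _; rewrite indicE.
Qed.

(** The covariance of the truncated excess of [B] with the event that [y] is
    displaced by [v]. *)
Definition flux (B : seq (site d)) (th : R) (v y : site d) : R :=
  mean mu (fun g => \1_(moves y v) g * probe (mu := mu) (p := p) th B g).

Lemma flux_le B th v y : `|flux B th v y| <= 2 * move_prob v.
Proof.
rewrite -(mean_moves y v); apply: mean_mul_le.
- exact: bounded_measurable_moves.
- exact: bounded_measurable_probe.
- by apply: aeW => g; rewrite indicE.
- by move=> g; exact: probe_le2.
Qed.

Lemma mixing_moves (V : seq (site d)) (e : R) : 0 < e ->
  exists2 eta, 0 < eta & forall th, 0 < th <= eta ->
    forall B, uniq B -> forall v, v \in V -> forall y, `|flux B th v y| <= e.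
Proof.
move=> e0; elim: V => [|w V [eta eta0 IH]]; first by exists 1.
have [eta' eta'0 H] := mixing_measurable hp hmu (measurable_moves 0 w) e0.
exists (Num.min eta eta'); first by rewrite lt_min eta0.
move=> th /andP[th0]; rewrite le_min => /andP[h1 h2] B uB v.
rewrite inE => /orP[/eqP -> y|vV y]; last by apply: IH => //; rewrite th0.
by rewrite /flux moves_shift; apply: H => //; rewrite th0.
Qed.

Lemma ae_inflow_le : {ae mu, forall g : config d, forall y V, uniq V ->
  \sum_(v <- V) \1_(moves (y - v) v) g <= p^-1 * (g y)%:R}.
Proof.
apply: filterS (bar_balanced hPhi) => g hg y V uV.
under eq_bigr do rewrite indic_moves subrK.
pose W := [seq y - v | v <- V & Phi g (y - v) == Some y].
have -> : \sum_(v <- V) (Phi g (y - v) == Some y)%:R = (size W)%:R :> R.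
  rewrite -natr_sum size_map size_filter -sum1_count [in RHS]big_mkcond/=.
  by congr _%:R; apply: eq_bigr => v _; case: ifP.
apply: counting_size_le (hg y).
  by rewrite map_inj_uniq ?filter_uniq// => a b /addrI /oppr_inj.
by move=> _ /mapP[v + ->]; rewrite mem_filter => /andP[/eqP].
Qed.

(** The covariance of the truncated excess of [B] with the number of sites
    displaced by [v] into [B] minus the number of sites of [B] displaced by
    [v]; displacements inside [B] cancel. *)
Definition net_flux (B : seq (site d)) (th : R) (v : site d) : R :=
  \sum_(y <- B) flux B th v (y - v) - \sum_(y <- B) flux B th v y.

(** Mass balance for the set [B]: up to what travels by a displacement outside
    [V], its excess is the inflow minus the outflow. *)
Lemma mean_excess_probe_le (B V : seq (site d)) th : uniq B -> uniq V ->
  `|mean mu (fun g => excess p B g * probe (mu := mu) (p := p) th B g)| <=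
  \sum_(v <- V) `|net_flux B th v|
  + 4 * ((size B)%:R * (1 - \sum_(v <- V) move_prob v)).
Proof.
move=> uB uV; set q := \sum_(v <- V) move_prob v; set N := (size B)%:R.
pose pr := probe (mu := mu) (p := p) th B.
have bp : bounded_measurable pr by exact: bounded_measurable_probe.
pose inflow g : R := \sum_(v <- V) \sum_(y <- B) \1_(moves (y - v) v) g.
pose outflow g : R := \sum_(v <- V) \sum_(y <- B) \1_(moves y v) g.
have binner (f : site d -> site d -> site d) v :
    bounded_measurable (fun g => \sum_(y <- B) \1_(moves (f y v) v) g : R).
  by apply: bounded_measurable_sum => y; exact: bounded_measurable_moves.
have bin : bounded_measurable inflow.
  by apply: bounded_measurable_sum => v; exact: (binner (fun y v => y - v)).
have bout : bounded_measurable outflow.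
  by apply: bounded_measurable_sum => v; exact: (binner (fun y v => y)).
have mflow (f : site d -> site d -> site d) :
    mean mu (fun g => \sum_(v <- V) \sum_(y <- B) \1_(moves (f y v) v) g) =
    N * q.
  rewrite mean_sum; last by move=> v; exact: binner.
  rewrite /q mulr_sumr; apply: eq_bigr => v _.
  rewrite mean_sum; last by move=> y; exact: bounded_measurable_moves.
  under eq_bigr do rewrite mean_moves.
  by rewrite big_const_seq count_predT iter_addr_0 mulr_natl.
have mi : mean mu inflow = N * q by exact: (mflow (fun y v => y - v)).
have mout : mean mu outflow = N * q by exact: (mflow (fun y v => y)).
have bex := bounded_measurable_excess_id (p := p) B.
(* the allocations to and from [B] by a displacement outside [V] *)
pose rin g := (excess p B g + N) - inflow g.
pose rout g := N - outflow g.
have bsum : bounded_measurable (fun g => excess p B g + N).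
  by apply: bounded_measurableD => //; exact: bounded_measurable_cst.
have brin : bounded_measurable rin by exact: bounded_measurableB.
have brout : bounded_measurable rout.
  by apply: bounded_measurableB => //; exact: bounded_measurable_cst.
have mrin : mean mu rin = N * (1 - q).
  rewrite meanB// mi meanD//; last exact: bounded_measurable_cst.
  by rewrite (mean_excess0 hp hmu uB) mean_cst; ring.
have mrout : mean mu rout = N * (1 - q).
  rewrite meanB//; last exact: bounded_measurable_cst.
  by rewrite mout mean_cst; ring.
have NE : N = \sum_(y <- B) 1.
  by rewrite big_const_seq count_predT iter_addr_0.
have rin0 : {ae mu, forall g, 0 <= rin g}.
  apply: filterS ae_inflow_le => g hg; rewrite /rin subr_ge0 /inflow.
  rewrite exchange_big/= /excess.
  rewrite NE.
  rewrite -big_split/=; apply: ler_sum => y _.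
  by rewrite /step subrK; exact: hg.
have rout0 g : 0 <= rout g.
  rewrite /rout subr_ge0 /outflow exchange_big/=.
  rewrite NE.
  apply: ler_sum => y _.
  rewrite (eq_bigr (fun v =>
    1 * (omap (fun z => z - y) (Phi g y) == Some v)%:R)).
    exact: (sum_pick_le (f := fun=> 1)).
  move=> v _; rewrite indic_moves mul1r; congr (nat_of_bool _)%:R.
  case: (Phi g y) => //= z; apply/eqP/eqP => -[].
    by move=> ->; rewrite addrC addKr.
  by move=> <-; rewrite addrC subrK.
have -> : (fun g => excess p B g * pr g) =
    fun g => ((inflow g - outflow g) * pr g + rin g * pr g) - rout g * pr g.
  by apply/funext => g; rewrite /rin /rout; ring.
have b1 : bounded_measurable (fun g => (inflow g - outflow g) * pr g).
  by apply: bounded_measurableM => //; exact: bounded_measurableB.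
have b2 : bounded_measurable (fun g => rin g * pr g).
  exact: bounded_measurableM.
have b3 : bounded_measurable (fun g => rout g * pr g).
  exact: bounded_measurableM.
rewrite meanB//; last exact: bounded_measurableD.
rewrite meanD//.
rewrite (le_trans (ler_normB _ _))//.
have h2 : `|mean mu (fun g => rin g * pr g)| <= 2 * (N * (1 - q)).
  by rewrite -mrin; apply: mean_mul_le => // g; exact: probe_le2.
have h3 : `|mean mu (fun g => rout g * pr g)| <= 2 * (N * (1 - q)).
  rewrite -mrout; apply: mean_mul_le => //; first exact: aeW.
  by move=> g; exact: probe_le2.
have h1 : `|mean mu (fun g => (inflow g - outflow g) * pr g)| <=
    \sum_(v <- V) `|net_flux B th v|.
  have bflow (f : site d -> site d -> site d) v : bounded_measurable
      (fun g => \sum_(y <- B) \1_(moves (f y v) v) g * pr g).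
    apply: bounded_measurable_sum => y.
    by apply: bounded_measurableM => //; exact: bounded_measurable_moves.
  have mfl (f : site d -> site d -> site d) v :
      mean mu (fun g => \sum_(y <- B) \1_(moves (f y v) v) g * pr g) =
      \sum_(y <- B) flux B th v (f y v).
    rewrite mean_sum// => y.
    by apply: bounded_measurableM => //; exact: bounded_measurable_moves.
  rewrite (_ : (fun g => (inflow g - outflow g) * pr g) = fun g =>
    \sum_(v <- V) (\sum_(y <- B) \1_(moves (y - v) v) g * pr g -
                   \sum_(y <- B) \1_(moves y v) g * pr g)); last first.
    apply/funext => g; rewrite /inflow /outflow mulrBl !mulr_suml -sumrB.
    by apply: eq_bigr => v _; rewrite !mulr_suml.
  rewrite mean_sum; last first.
    move=> v; apply: bounded_measurableB.
      exact: (bflow (fun y v => y - v)).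
    exact: (bflow (fun y v => y)).
  apply: le_trans (ler_norm_sum _ _ _) _; apply: ler_sum => v _.
  rewrite meanB; last 2 first.
  - exact: (bflow (fun y v => y - v)).
  - exact: (bflow (fun y v => y)).
  by rewrite (mfl (fun y v => y - v)) (mfl (fun y v => y)).
have := ler_normD (mean mu (fun g => (inflow g - outflow g) * pr g))
  (mean mu (fun g => rin g * pr g)).
move: h1 h2 h3; lra.
Qed.

End Transport.

(** * The expected displacement *)

Section Expectation.
Context {R : realType} {d : nat} {p : R} {mu : probability (config d) R}.
Context {disp : measure_display} {Omega : measurableType disp}.
Variables (P : probability Omega R) (Gamma : {RV P >-> config d}).
Hypothesis hGamma : forall A : set (config d), measurable A ->
  distribution P Gamma A = mu A.
Variable Phi : config d -> site d -> option (site d).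
Hypothesis hPhi : balanced_allocation_rule p mu Phi.

(** A lower bound of the expectation which needs no integrability. *)
Lemma moment_sum_le (a : R) (V : seq (site d)) : uniq V ->
  ((\sum_(v <- V) enorm R v `^ a * move_prob (mu := mu) Phi v)%:E <=
   'E_P[(fun w => allocation_norm R (Phi (Gamma w) 0) `^ a)%R])%E.
Proof.
move=> uV.
have mA v : measurable (Gamma @^-1` moves Phi 0 v).
  rewrite -[X in measurable X]setTI.
  by apply: measurable_funP => //; exact: (measurable_moves hPhi).
pose Y w : R := \sum_(v <- V) enorm R v `^ a * \1_(Gamma @^-1` moves Phi 0 v) w.
have bt v : bounded_measurable
    (fun w => enorm R v `^ a * \1_(Gamma @^-1` moves Phi 0 v) w).
  by apply: bounded_measurableZ; exact: bounded_measurable_indic.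
have bY : bounded_measurable Y by exact: bounded_measurable_sum.
have -> : \sum_(v <- V) enorm R v `^ a * move_prob (mu := mu) Phi v = mean P Y.
  rewrite mean_sum//; apply: eq_bigr => v _.
  rewrite meanZ; last exact: bounded_measurable_indic.
  rewrite mean_indic//; congr (_ * fine _).
  by rewrite -hGamma//; exact: (measurable_moves hPhi).
rewrite unlock /mean /Rintegral fineK; last first.
  by apply: integrable_fin_num => //; exact: bounded_measurable_integrable.
apply: ge0_le_integral => //.
- move=> w _; rewrite lee_fin; apply: sumr_ge0 => v _.
  by rewrite mulr_ge0 ?powR_ge0// indicE.
- by apply/measurable_EFinP; exact: bY.1.
- apply/measurable_EFinP => _ Z mZ; rewrite setTI.
  rewrite (_ : _ @^-1` Z = Gamma @^-1`
    [set g | [set o | Z (allocation_norm R o `^ a)] (Phi g 0)]); last by [].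
  rewrite -[X in measurable X]setTI.
  by apply: measurable_funP => //; exact: (bar_measurable hPhi).
move=> w _; rewrite lee_fin /Y.
rewrite (eq_bigr (fun v => enorm R v `^ a * (Phi (Gamma w) 0 == Some v)%:R)).
  apply: sum_pick_le => //; first exact: powR_ge0.
  by move=> v ->.
move=> v _; congr (_ * _).
by have := indic_moves (R := R) Phi 0 v (Gamma w); rewrite add0r.
Qed.

End Expectation.

Theorem corollary8 (R : realType) (d : nat) (hd : d = 1%N \/ d = 2%N)
  (p : R) (hp : 0 < p < 1) (hpk : exists k : int, p = k%:~R^-1)
  (mu : probability (config d) R) (hmu : is_product_measure p mu)
  (disp : measure_display) (Omega : measurableType disp)
  (P : probability Omega R) (Gamma : {RV P >-> config d})
  (hGamma : forall A : set (config d), measurable A ->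
    distribution P Gamma A = mu A)
  (Phi : config d -> site d -> option (site d))
  (hPhi : balanced_allocation_rule p mu Phi) :
  'E_P[(fun w => allocation_norm R (Phi (Gamma w) 0) `^ (d%:R / 2))%R]%E = +oo%E.
Proof.
apply: contrapT => Efin.
pose h (v : site d) : R := enorm R v `^ (d%:R / 2).
pose q (v : site d) : R := move_prob (mu := mu) Phi v.
have h0 v : 0 <= h v by exact: powR_ge0.
have q0 v : 0 <= q v by exact: move_prob_ge0.
have [H hH] : exists H : R, forall V, uniq V -> \sum_(v <- V) h v * q v <= H.
  move: (moment_sum_le hGamma hPhi (d%:R / 2)) Efin.
  case: ('E_P[_])%E => [H|//|] hH _.
    by exists H => V uV; rewrite -lee_fin; exact: hH.
  by have := hH [::] isT; rewrite leeNy_eq.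
have [c [delta [c0 delta0 lower]]] := excess_clamp_lower (d := d) hp hmu.
have e0 : 0 < delta / 32 by rewrite divr_gt0.
have hq0 v : 0 <= h v * q v by exact: mulr_ge0.
have [V0 uV0 tail] := bounded_sums_tail hq0 hH e0.
pose H0 := \sum_(v <- V0) h v.
have H00 : 0 <= H0 by exact: sumr_ge0.
have e'0 : 0 < delta / (16 * (H0 + 1)).
  by rewrite divr_gt0// mulr_gt0// ltr_wpDl.
have [eta eta0 mix] := mixing_moves hp hmu hPhi V0 e'0.
(* the size of the cube is such that [c / sqrt N <= eta] *)
pose n := Num.bound ((c / eta) ^+ 2).
have nbig : (c / eta) ^+ 2 < n%:R.
  by rewrite archi_boundP// sqr_ge0.
have n_gt0 : (0 < n)%N.
  by rewrite -(ltr_nat R); apply: le_lt_trans nbig; exact: sqr_ge0.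
pose B := cube (d := d) n.
have uB : uniq B by exact: cube_uniq.
pose r : R := Num.sqrt (size B)%:R.
have r2 : r ^+ 2 = (size B)%:R by rewrite sqr_sqrtr.
have rn : r ^+ 2 = (n ^ d)%:R by rewrite r2 size_cube.
have r0 : 0 < r by rewrite sqrtr_gt0 size_cube ltr0n expn_gt0 n_gt0.
have th_le : 0 < c / r <= eta.
  rewrite divr_gt0//= ler_pdivrMr// mulrC -ler_pdivrMr//.
  rewrite -(@ler_sqr R) ?nnegrE ?divr_ge0 ?(ltW c0) ?(ltW eta0) ?(ltW r0)//.
  rewrite rn (le_trans (ltW nbig))// ler_nat.
  by case: hd => ->; rewrite ?expn1// expnS expn1 leq_pmulr.
have er0 : 0 < delta / (16 * r) by rewrite divr_gt0// mulr_gt0.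
have [W uW exhaust] := move_prob_exhaust hmu hPhi uV0 er0.
set th := c / r in th_le.
have cov : mean mu (fun g => excess p B g * clamp (th * excess p B g)) =
    mean mu (fun g => excess p B g * probe (mu := mu) (p := p) th B g).
  set m := mean mu (fun g => clamp (th * excess p B g)).
  have bex := bounded_measurable_excess_id (p := p) B.
  have bcl := bounded_measurable_clamp (p := p) th B.
  rewrite (_ : (fun g => excess p B g * probe (mu := mu) (p := p) th B g) =
    fun g => excess p B g * clamp (th * excess p B g) - m * excess p B g).
    rewrite meanB; [|exact: bounded_measurableM|exact: bounded_measurableZ].
    by rewrite meanZ// (mean_excess0 hp hmu uB) mulr0 subr0.
  by apply/funext => g; rewrite /probe -/m; ring.
have := lower B r uB r0 r2; rewrite -/th cov => low.
have := le_trans low (le_trans (ler_norm _)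
  (mean_excess_probe_le hp hmu hPhi th uB uW)).
apply/negP; rewrite -ltNge.
have flux_term v e :
    (forall y, `|flux (p := p) (mu := mu) Phi B th v y| <= e) ->
    `|net_flux (p := p) (mu := mu) Phi B th v| <= 4 * r * (h v * e).
  move=> ue; apply: le_trans (sum_exits n v ue) _.
  have ee0 : 0 <= e by apply: le_trans (ue 0); exact: normr_ge0.
  have h1 := size_exits_le v hd r0 rn; have h2 := size_exits_le (- v) hd r0 rn.
  rewrite enormN in h2; rewrite mulrA ler_wpM2r//.
  by move: h1 h2; rewrite -/(h v); lra.
rewrite big_cat/=.
(* each of the three error terms is at most a quarter of the lower bound *)
have sum0 : \sum_(v <- V0) `|net_flux (p := p) (mu := mu) Phi B th v|
    <= delta * r / 4.
  apply: (@le_trans _ _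
    (\sum_(v <- V0) 4 * r * (h v * (delta / (16 * (H0 + 1)))))).
    rewrite big_seq [leRHS]big_seq; apply: ler_sum => v vV.
    by apply: flux_term => y; exact: mix.
  rewrite -mulr_sumr -mulr_suml -/H0.
  rewrite (_ : 4 * r * _ = (delta * r / 4) * (H0 / (H0 + 1))); last first.
    by field; rewrite gt_eqF// ltr_wpDl.
  rewrite ler_piMr ?divr_ge0 ?mulr_ge0 ?(ltW delta0) ?(ltW r0)//.
  by rewrite ler_pdivrMr ?ltr_wpDl// mul1r lerDl.
have sum1 : \sum_(v <- W) `|net_flux (p := p) (mu := mu) Phi B th v|
    <= delta * r / 4.
  apply: (@le_trans _ _ (\sum_(v <- W) 8 * r * (h v * q v))).
    apply: ler_sum => v _.
    rewrite (_ : 8 * r * _ = 4 * r * (h v * (2 * q v))); last by ring.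
    by apply: flux_term => y; exact: flux_le.
  rewrite -mulr_sumr (_ : delta * r / 4 = 8 * r * (delta / 32)); last by field.
  by rewrite ler_wpM2l ?mulr_ge0 ?(ltW r0)//; exact: tail.
have rest : 4 * ((size B)%:R * (1 - \sum_(v <- V0 ++ W) q v)) <= delta * r / 4.
  rewrite (_ : delta * r / 4 = 4 * ((size B)%:R * (delta / (16 * r)))).
    by rewrite ler_wpM2l// ler_wpM2l.
  by rewrite -r2; field; rewrite gt_eqF.
have dr : 0 < delta * r by exact: mulr_gt0.
by move: sum0 sum1 rest; rewrite /q big_cat/=; lra.
Qed.
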